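(* Let $k\ge 2$. If $X\subseteq V(G_k)$ is small, then there exist $i,j$ such that $R_i\cap X=C_j\cap X=\emptyset$.
   Context: $G_k$ is the $k\times k$-grid with vertex set $\{(i,j):1\le i,j\le k\}$ and edges $(i,j)(i',j')$ with $|i-i'|+|j-j'|=1$. $C_i=\{(i,j):1\le j\le k\}$ and $R_j=\{(i,j):1\le i\le k\}$. For $X\subseteq V(G_k)$, $\operatorname{mm}(X)$ is the size of a maximum matching in $G_k$ among the edges with one end in $X$ and the other in $V(G_k)\setminus X$. A set $X\subseteq V(G_k)$ is small if $\operatorname{mm}(X)<k$ and $R_i\not\subseteq X$ for all $i=1,\dots,k$. *)

(* Defs.v *)
From mathcomp Require Import all_boot all_order all_algebra.

Set Implicit Arguments.
Unset Strict Implicit.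
Unset Printing Implicit Defensive.

(* Coordinates are shifted from 1..k to 0..k-1. *)
Definition vertex (k : nat) : finType := ('I_k * 'I_k)%type.

(* `|m - n| is the distance in int (absz), not truncated subtraction. *)
Definition grid_adj (k : nat) : rel (vertex k) :=
  fun u v => `|u.1 - v.1| + `|u.2 - v.2| == 1.

Definition grid_edges (k : nat) : {set {set vertex k}} :=
  [set [set p.1; p.2] | p : vertex k * vertex k & grid_adj p.1 p.2].

(* As in the paper, columns fix the first coordinate and rows the second. *)
Definition grid_column (k : nat) (i : 'I_k) : {set vertex k} :=
  [set (i, j) | j : 'I_k].

Definition grid_row (k : nat) (j : 'I_k) : {set vertex k} :=
  [set (i, j) | i : 'I_k].

Definition boundary_edges (k : nat) (X : {set vertex k}) : {set {set vertex k}} :=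
  [set e in grid_edges k |
    [exists x in X, exists y in ~: X, e == [set x; y]]].

Definition is_matching (k : nat) (M : {set {set vertex k}}) : bool :=
  (M \subset grid_edges k) &&
  [forall e in M, forall f in M, (e != f) ==> [disjoint e & f]].

Definition mm (k : nat) (X : {set vertex k}) : nat :=
  \max_(M : {set {set vertex k}} | is_matching M && (M \subset boundary_edges X))
     #|M|.

Definition small (k : nat) (X : {set vertex k}) : Prop :=
  mm X < k /\ forall i : 'I_k, ~~ (grid_row i \subset X).

(* Main.v *)
Require Import Defs.
From mathcomp Require Import all_boot all_order all_algebra.
From mathcomp Require Import zify.

(** A line (row or column) that meets both [X] and its complement contains an
    edge leaving [X], and edges taken in distinct parallel lines are disjoint.
    Since [mm X < k], some row is not met in both ways; it is not inside [X],
    so it avoids [X]. Every column then meets the complement of [X], in that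
    row, so the same count over columns gives a column avoiding [X]. *)

(** Induction on the distance from [a] to [b]: move [a] one step towards [b]. Either this step
    leaves [P] and is the required pair, or it stays in [P] and the distance has dropped. *)
Lemma ord_crossing (k : nat) (P : pred 'I_k) (a b : 'I_k) :
  P a -> ~~ P b -> exists c d : 'I_k, [/\ P c, ~~ P d & `|c - d| = 1].
Proof.
have [n] := ubnP `|a - b|; elim: n => // n IHn in a b * => ltn Pa nPb.
have neq_ab : a != b by apply: contraNneq nPb => <-.
have {}neq_ab : (a : nat) <> b by move/val_inj/eqP; apply/negP.
have [lt_ab | le_ba] := ltnP a b.
- have lt_k : a.+1 < k by have := ltn_ord b; lia.
  have [Pc | nPc] := boolP (P (Ordinal lt_k)).
    by apply: (IHn (Ordinal lt_k) b) => //=; lia.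
  by exists a, (Ordinal lt_k); split=> //=; lia.
(* Since [b <= a] and the two differ, [a] is positive, so [a.-1] is a genuine neighbour. *)
- have lt_k : a.-1 < k by have := ltn_ord a; lia.
  have [Pc | nPc] := boolP (P (Ordinal lt_k)).
    by apply: (IHn (Ordinal lt_k) b) => //=; lia.
  by exists a, (Ordinal lt_k); split=> //=; lia.
Qed.

(** The label abstracts the index of a line, so that rows and columns share one count. Both ends of
    the [j]-th edge carry label [j], so edges with different labels have no common vertex, and the
    [k] edges form a matching. *)
Lemma leq_mm_labelled (k : nat) (X : {set vertex k}) (l : vertex k -> 'I_k) :
    (forall j : 'I_k, exists p : vertex k * vertex k,
       [/\ p.1 \in X, p.2 \notin X, grid_adj p.1 p.2, l p.1 = j & l p.2 = j]) ->
  k <= mm X.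
Proof.
move=> /fin_all_exists [p hp].
pose e j := [set (p j).1; (p j).2].
have le j z : z \in e j -> l z = j.
  by have [_ _ _ l1 l2] := hp j; rewrite !inE => /orP [] /eqP ->.
have pe j : (p j).1 \in e j by rewrite !inE eqxx.
have e_inj : injective e.
  by move=> i j eq_e; rewrite -(le i _ (pe i)) (le j) // -eq_e.
have eG j : e j \in grid_edges k.
  by apply/imsetP; exists (p j) => //; rewrite inE; have [_ _ ? _ _] := hp j.
have cardM : #|[set e j | j : 'I_k]| = k by rewrite card_imset ?card_ord.
rewrite -[X in X <= _]cardM /mm; apply: leq_bigmax_cond.
apply/andP; split; [apply/andP; split|].
- by apply/subsetP => _ /imsetP [j _ ->].
- apply/forall_inP => _ /imsetP [i _ ->]; apply/forall_inP => _ /imsetP [j _ ->].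
  (* A common vertex [z] would carry both labels [i] and [j], forcing the two edges to coincide. *)
  apply/implyP; apply: contraNT => /pred0Pn [z /andP [/= zi zj]].
  by rewrite -(le i z zi) (le j z zj).
- apply/subsetP => _ /imsetP [j _ ->]; rewrite inE eG /=.
  have [p1 p2 _ _ _] := hp j.
  apply/exists_inP; exists (p j).1 => //.
  by apply/exists_inP; exists (p j).2; rewrite ?inE.
Qed.

Lemma row_avoiding (k : nat) (X : {set vertex k}) :
    mm X < k -> (forall j, ~~ (grid_row j \subset X)) ->
  exists j, grid_row j :&: X = set0.
Proof.
move=> ltk nsub.
have [/existsP [j /eqP] | /existsPn meets] :=
  boolP [exists j : 'I_k, grid_row j :&: X == set0]; first by exists j.
suff: k <= mm X by rewrite leqNgt ltk.
(* The second coordinate is constant along a row, so it serves as the label. *)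
apply: (@leq_mm_labelled _ _ (fun v => v.2)) => j.
have /set0Pn [_ /setIP [/imsetP [a _ ->] aX]] := meets j.
have /subsetPn [_ /imsetP [b _ ->] bX] := nsub j.
have [c [d [cX dX cd]]] := @ord_crossing k (fun i => (i, j) \in X) a b aX bX.
by exists ((c, j), (d, j)); split=> //; rewrite /grid_adj /= cd distnn.
Qed.

Lemma column_avoiding (k : nat) (X : {set vertex k}) :
    mm X < k -> (forall i, ~~ (grid_column i \subset X)) ->
  exists i, grid_column i :&: X = set0.
Proof.
move=> ltk nsub.
have [/existsP [i /eqP] | /existsPn meets] :=
  boolP [exists i : 'I_k, grid_column i :&: X == set0]; first by exists i.
suff: k <= mm X by rewrite leqNgt ltk.
apply: (@leq_mm_labelled _ _ (fun v => v.1)) => i.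
have /set0Pn [_ /setIP [/imsetP [a _ ->] aX]] := meets i.
have /subsetPn [_ /imsetP [b _ ->] bX] := nsub i.
have [c [d [cX dX cd]]] := @ord_crossing k (fun j => (i, j) \in X) a b aX bX.
by exists ((i, c), (i, d)); split=> //; rewrite /grid_adj /= cd distnn.
Qed.

Theorem lemma4p4 (k : nat) (hk : 2 <= k) (X : {set vertex k}) (hX : small X) :
  exists i j : 'I_k, grid_row i :&: X = set0 /\ grid_column j :&: X = set0.
Proof.
have [ltk nsub] := hX.
have [i hi] := row_avoiding _ _ ltk nsub.
have nsubc j : ~~ (grid_column j \subset X).
  (* The witness is the vertex where column [j] crosses the avoiding row [i]. *)
  apply/subsetPn; exists (j, i); first exact: imset_f.
  apply/negP => jiX; have: (j, i) \in grid_row i :&: X.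
    by rewrite inE jiX andbT; apply/imsetP; exists j.
  by rewrite hi inE.
by have [j hj] := column_avoiding _ _ ltk nsubc; exists i, j.
Qed.
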